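(* Let $(X,\mu)$ be a standard probability space and let $f_1,\dots,f_n:X\to X$ be bounded-to-one Borel functions such that the graph $\mathcal{G}_{f_1,\dots,f_n}$ is pmp. Then $\chi_\mu^{\mathrm{ap}}(\mathcal{G}_{f_1,\dots,f_n})\le 2n+1$.
   Context: The graph $\mathcal{G}_{f_1,\dots,f_n}$ generated by $f_1,\dots,f_n$ is the graph on $X$ in which $x,y$ are adjacent iff $x\ne y$ and there is $i\le n$ with $f_i(x)=y$ or $f_i(y)=x$. A Borel graph is pmp if every partial Borel bijection of $X$ whose graph is contained in the connectedness relation of the graph preserves $\mu$. $\chi_\mu^{\mathrm{ap}}(\mathcal{G})$ is the least $k$ such that for every $\varepsilon>0$ there is a Borel $A\subseteq X$ with $\mu(A)>1-\varepsilon$ such that the induced subgraph $\mathcal{G}\restriction A$ admits a $\mu$-measurable proper $k$-coloring. *)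

(* Defs.v *)
From HB Require Import structures.
From mathcomp Require Import all_boot all_order all_algebra.
From mathcomp Require Import all_classical all_reals all_analysis.
From Stdlib Require Import Relations.Relation_Operators.
From Stdlib Require List.

Set Implicit Arguments.
Unset Strict Implicit.
Unset Printing Implicit Defensive.

Import Order.TTheory GRing.Theory Num.Theory.
Local Open Scope classical_set_scope.
Local Open Scope ring_scope.

(* Standard Borel space: Borel isomorphic to a Borel subset of the real line
   (Kuratowski's characterization of standard Borel spaces). *)
Definition standard_borel (d : measure_display) (X : measurableType d)
    (R : realType) : Prop :=
  exists e : X -> R,
    injective e /\ measurable_fun setT e /\ measurable (range e) /\
    (forall A : set X, measurable A -> measurable (e @` A)).

Definition bounded_to_one (X : Type) (f : X -> X) : Prop :=
  exists M : nat, forall y : X, exists s : seq X,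
    (size s <= M)%N /\ (forall x, f x = y -> List.In x s).

Definition gen_graph (X : Type) (n : nat) (f : 'I_n -> X -> X) (x y : X) : Prop :=
  x <> y /\ exists i : 'I_n, f i x = y \/ f i y = x.

Definition connectedness (X : Type) (G : X -> X -> Prop) : X -> X -> Prop :=
  clos_refl_trans X G.

Definition pmp_graph (d : measure_display) (X : measurableType d) (R : realType)
    (mu : set X -> \bar R) (G : X -> X -> Prop) : Prop :=
  forall (A B : set X) (phi : X -> X),
    measurable A -> measurable B ->
    measurable_fun A phi -> {in A &, injective phi} -> phi @` A = B ->
    (forall C, measurable C -> C `<=` A -> measurable (phi @` C)) ->
    (forall x, A x -> connectedness G x (phi x)) ->
    forall C, measurable C -> C `<=` A -> mu (phi @` C) = mu C.

Definition mu_measurable (d : measure_display) (X : measurableType d) (R : realType)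
    (mu : set X -> \bar R) (S : set X) : Prop :=
  exists B N : set X, measurable B /\ measurable N /\ mu N = 0%E /\
    ((S `\` B) `|` (B `\` S)) `<=` N.

Definition mu_meas_colorable_on (d : measure_display) (X : measurableType d)
    (R : realType) (mu : set X -> \bar R) (G : X -> X -> Prop) (A : set X)
    (k : nat) : Prop :=
  exists c : X -> nat,
    (forall x, A x -> (c x < k)%N) /\
    (forall i : nat, mu_measurable mu (A `&` c @^-1` [set i])) /\
    (forall x y, A x -> A y -> G x y -> c x <> c y).

Definition ap_colorable (d : measure_display) (X : measurableType d) (R : realType)
    (mu : set X -> \bar R) (G : X -> X -> Prop) (k : nat) : Prop :=
  forall eps : R, 0 < eps -> exists A : set X,
    measurable A /\ ((1 - eps)%:E < mu A)%E /\ mu_meas_colorable_on mu G A k.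

Definition chi_ap_le (d : measure_display) (X : measurableType d) (R : realType)
    (mu : set X -> \bar R) (G : X -> X -> Prop) (m : nat) : Prop :=
  exists k : nat, (k <= m)%N /\ ap_colorable mu G k.

(* Main.v *)
Require Import Defs.
From HB Require Import structures.
From mathcomp Require Import all_boot all_order all_algebra.
From mathcomp Require Import all_classical all_reals all_analysis.
From mathcomp Require Import measurable_realfun.
From mathcomp Require Import zify lra.
From Stdlib Require Import Relations.Relation_Operators.

Set Implicit Arguments.
Unset Strict Implicit.
Unset Printing Implicit Defensive.

Import Order.TTheory GRing.Theory Num.Theory.
Import numFieldNormedType.Exports.
Local Open Scope classical_set_scope.
Local Open Scope ring_scope.

(**
  On a measurable set [A], the in-degrees of the functions restricted to [A]
  have total mass at most [n * mu A], because the graph is pmp; by Markov's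
  inequality the points of [A] with more than [n] incoming edges from [A] have
  mass at most [n / (n + 1) * mu A], and every other point has at most [2 n]
  neighbors in [A].  Peeling these other points off repeatedly exhausts the
  space up to measure [eps].  Coloring the peeled layers greedily, last layer
  first, each point sees at most [2 n] colored neighbors.  Within a layer the
  points are colored in finitely many rounds, one for each of finitely many
  independent sets: [f i x <> x] is witnessed by a rational separating [x] from
  [f i x], which yields countably many independent sets covering the space, and
  finitely many of them cover it up to [eps].

  Images under [f i] must be measurable for this.  Instead of the theorems of
  Lusin-Souslin and Lusin-Novikov, one discards a set of small measure: off it
  [f i] is continuous on a closed set [K] in the real coordinate [e], so it maps
  the traces on [K] of closed intervals to measurable sets, and as its fibers
  are finite, [K] is a countable union of measurable pieces on which [f i] is
  injective.
*)

(** * Approximation in finite measure *)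

Section finite_measures.
Context (d : measure_display) (X : measurableType d) (R : realType).
Variable mu : {finite_measure set X -> \bar R}.

Lemma measure_tail (F : nat -> set X) (eps : R) :
  (forall i, measurable (F i)) -> 0 < eps ->
  exists N, (mu (\bigcup_i F i `\` \bigcup_(i < N) F i) < eps%:E)%E.
Proof.
move=> mF eps0.
pose G n := \bigcup_i F i `\` \bigcup_(i < n) F i.
have mG n : measurable (G n).
  by apply: measurableD; apply: bigcup_measurable.
have G0 : \bigcap_n G n = set0.
  apply/seteqP; split=> // x Gx.
  have [[i _ Fix] _] := Gx O I.
  by have [_] := Gx i.+1 I; apply; exists i => /=.
have /(_ [set z | z < eps%:E]%E) : mu \o G @ \oo --> mu (\bigcap_n G n).
  apply: nonincreasing_cvg_mu => //.
  - by rewrite -ge0_fin_numE// fin_num_measure.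
  - by rewrite G0.
  - move=> m k mk; apply/subsetPset => x [Fx nFx]; split=> // -[i /= im Fix].
    by apply: nFx; exists i => //=; exact: leq_trans mk.
rewrite G0 measure0 => h.
have [|N _ /(_ N (leqnn N))] := h.
  by apply: open_ereal_lt'; rewrite lte_fin.
by exists N.
Qed.

Lemma measure_bigcup_le (F : nat -> set X) (eps : R) :
  (forall k, measurable (F k)) -> 0 <= eps ->
  (forall k, mu (F k) <= (eps / (2 ^ k.+1)%:R)%:E)%E ->
  (mu (\bigcup_k F k) <= eps%:E)%E.
Proof.
move=> mF eps0 Feps.
apply: (le_trans (measure_sigma_subadditive mu mF _ (@subset_refl _ _))).
  exact: bigcup_measurable.
apply: le_trans (epsilon_trick0 xpredT eps0).
by apply: lee_nneseries => // i _ ; exact: Feps.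
Qed.

Lemma le_measure_sub (A B : set X) : measurable A -> measurable B -> A `<=` B ->
  (mu A <= mu B)%E.
Proof. by move=> mA mB; apply: le_measure; rewrite inE. Qed.

(** Regularity of the image of [mu] under [e]: the sets of reals that can be so approximated for
    every [eps] form a sigma-algebra, which contains the generating closed rays. *)
Lemma closed_open_approx (e : X -> R) (S : set R) :
  measurable_fun setT e -> measurable S ->
  forall eps : R, 0 < eps -> exists F U : set R,
  [/\ closed F, open U, F `<=` S, S `<=` U &
      (mu (e @^-1` (U `\` F)) <= eps%:E)%E].
Proof.
move=> me mS.
have mpre (B : set R) : measurable B -> measurable (e @^-1` B).
  by move=> mB; rewrite -[X in measurable X]setTI; exact: me.
pose P (B : set R) := forall eps : R, 0 < eps -> exists F U : set R,
  [/\ closed F, open U, F `<=` B, B `<=` U &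
      (mu (e @^-1` (U `\` F)) <= eps%:E)%E].
suff : measurable `<=` P by apply.
have -> : @measurable _ R = <<s @RGenCInfty.G R >>.
  exact: RGenCInfty.measurableE.
apply: smallest_sub; last first.
  move=> _ [x ->] eps eps0.
  pose T n := e @^-1` `]-oo, x - n.+1%:R^-1]%classic.
  have [N hN] : exists N, (mu (\bigcup_i T i `\` \bigcup_(i < N) T i) < eps%:E)%E.
    by apply: measure_tail => // i; exact: mpre.
  (* The ray is closed already; the gap up to the open ray meets no [T i] with [i < N], so it is
     part of the small tail. *)
  exists `[x, +oo[%classic, `]x - N.+1%:R^-1, +oo[%classic; split=> //.
  - exact: interval_closed.
  - by move=> y; rewrite /= !in_itv/= !andbT; apply: lt_le_trans; rewrite gtrBl.
  apply/ltW; apply: le_lt_trans hN; apply: le_measure_sub.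
  - by apply: mpre; apply: measurableD.
  - by apply: measurableD; apply: bigcup_measurable => k _; exact: mpre.
  move=> t /=; rewrite !in_itv/= !andbT => -[tx /negP]; rewrite -ltNge => xt.
  split.
    have : 0 < x - e t by rewrite subr_gt0.
    move=> /ltr_add_invr[k]; rewrite add0r => hk.
    by exists k => //; rewrite /T/= in_itv/= lerBrDr addrC -lerBrDr ltW.
  case=> i /= iN; rewrite /T/= in_itv/=; apply/negP; rewrite -ltNge.
  apply: le_lt_trans tx; rewrite lerD2l lerN2 lef_pV2 ?posrE// ler_nat.
  by rewrite ltnW.
split.
- move=> eps eps0; exists set0, set0; split => //.
  + exact: closed0.
  + by rewrite setD0 preimage_set0 measure0 lee_fin ltW.
- move=> B PB eps /PB[F [U [cF oU FB BU h]]]; exists (~` U), (~` F); split.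
  + exact: open_closedC.
  + exact: closed_openC.
  + by rewrite setTD; exact: subsetC.
  + by rewrite setTD; exact: subsetC.
  + by rewrite setDE setCK setIC -setDE.
- move=> B PB eps eps0.
  have e2 : 0 < eps / 2 by rewrite divr_gt0.
  have /choice[F /choice[U FU]] k : exists F, exists U : set R,
      [/\ closed F, open U, F `<=` B k, B k `<=` U &
      (mu (e @^-1` (U `\` F)) <= (eps / 2 / (2 ^ k.+1)%:R)%:E)%E].
    by apply: PB; rewrite divr_gt0.
  have mF k : measurable (F k) by apply: closed_measurable; case: (FU k).
  have mU k : measurable (U k) by apply: open_measurable; case: (FU k).
  have [N hN] := measure_tail (fun k => mpre _ (mF k)) e2.
  (* Finitely many [F k] are kept so that the union stays closed: half of [eps] pays for the tail
     [T1], half for the gaps [T2]. *)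
  exists (\bigcup_(k < N) F k), (\bigcup_k U k); split.
  + rewrite bigcup_mkord; elim/big_ind : _ => [|A C|i _]; first exact: closed0.
      exact: closedU.
    by case: (FU i).
  + by apply: bigcup_open => k _; case: (FU k).
  + by move=> x [k _ Fx]; exists k => //; case: (FU k) => _ _ + _ _; apply.
  + by move=> x [k _ Bx]; exists k => //; case: (FU k) => _ _ _ + _; apply.
  set T1 := (X in (mu X < _)%E) in hN.
  pose T2 := \bigcup_k (e @^-1` (U k `\` F k)).
  have mT1 : measurable T1.
    by apply: measurableD; apply: bigcup_measurable => k _; exact: mpre.
  have mk k : measurable (e @^-1` (U k `\` F k)) by apply: mpre; exact: measurableD.
  have mT2 : measurable T2 by exact: bigcup_measurable.
  apply: (@le_trans _ _ (mu (T1 `|` T2))).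
    apply: le_measure_sub.
    + by apply: mpre; apply: measurableD; exact: bigcup_measurable.
    + exact: measurableU.
    + move=> x [/= [k _ Ux] nF].
      have [Fx|nFx] := pselect (F k (e x)); last by right; exists k.
      by left; split; [exists k|].
  rewrite (le_trans (measureU2 _ _ _))// [eps]splitr EFinD leeD//.
    exact: ltW.
  by apply: measure_bigcup_le => //; [exact: ltW|move=> k; case: (FU k)].
Qed.

End finite_measures.

(** * Lusin's theorem in a real coordinate *)

Definition rat_enum (R : realType) (k : nat) : R :=
  if (unpickle k : option rat) is Some r then ratr r else 0.

Lemma rat_enum_dense (R : realType) (x y : R) : x < y ->
  exists k, x < rat_enum R k < y.
Proof.
move=> /rat_in_itvoo[r]; rewrite in_itv/= => xry.
by exists (pickle r); rewrite /rat_enum pickleK.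
Qed.

Section borel_embedding.
Context (d : measure_display) (X : measurableType d) (R : realType).
Variables (mu : {finite_measure set X -> \bar R}) (e : X -> R).
Hypotheses (injective_e : injective e) (measurable_e : measurable_fun setT e)
  (measurable_image_e : forall A : set X, measurable A -> measurable (e @` A)).

Let measurable_preimage_e (B : set R) : measurable B -> measurable (e @^-1` B).
Proof. by move=> mB; rewrite -[X in measurable X]setTI; exact: measurable_e. Qed.

(** The sets [g < q] and [q <= g], for [q] rational, are approximated from inside by closed sets.
    Where these still cover for every [q], [g] is a continuous function of the coordinate [e]; as
    this happens on a closed set, traces of segments are compact and have compact images. *)
Lemma lusin_interval_images (g : X -> R) (eps : R) : measurable_fun setT g -> 0 < eps ->
  exists K : set X, [/\ measurable K, (mu (~` K) <= eps%:E)%E &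
    forall a b : R, measurable (g @` (K `&` e @^-1` `[a, b]%classic))].
Proof.
move=> mg eps0.
pose q := rat_enum R.
pose S (b : bool) k := if b then [set x | g x < q k] else [set x | q k <= g x].
have mS b k : measurable (S b k).
  rewrite /S; case: b.
    have := mg measurableT `]-oo, q k[%classic (measurable_itv _).
    by rewrite setTI set_itvNyo.
  have := mg measurableT `[q k, +oo[%classic (measurable_itv _).
  by rewrite setTI set_itvcy.
have /choice[F /choice[U FU]] : forall bk : bool * nat,
    exists F U : set R, [/\ closed F, open U, F `<=` e @` S bk.1 bk.2,
    e @` S bk.1 bk.2 `<=` U &
    (mu (e @^-1` (U `\` F)) <= (eps / 2 / (2 ^ bk.2.+1)%:R)%:E)%E].
  move=> [b k] /=; apply: closed_open_approx => //; first exact: measurable_image_e.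
  by rewrite !divr_gt0.
have mF bk : measurable (F bk) by apply: closed_measurable; case: (FU bk).
have mU bk : measurable (U bk) by apply: open_measurable; case: (FU bk).
pose K' := \bigcap_k (F (true, k) `|` F (false, k)).
have cK' : closed K'.
  apply: closed_bigI => k _; apply: closedU; first by case: (FU (true, k)).
  by case: (FU (false, k)).
have mK' : measurable K' by exact: closed_measurable.
exists (e @^-1` K'); split; first exact: measurable_preimage_e.
  pose T b k := e @^-1` (U (b, k) `\` F (b, k)).
  have mT b k : measurable (T b k) by apply: measurable_preimage_e; exact: measurableD.
  apply: (@le_trans _ _ (mu (\bigcup_k (T true k `|` T false k)))).
    apply: le_measure_sub.
    - by apply: measurableC; exact: measurable_preimage_e.
    - by apply: bigcup_measurable => k _; exact: measurableU.
    - move=> x /= nK; apply: contrapT => nT; apply: nK => k _.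
      (* Both closed sets for [k] miss [e x], so whichever level set contains [x] puts it in the
         corresponding gap. *)
      apply: contrapT => /not_orP[n1 n2]; apply: nT; exists k => //.
      have [gx|gx] := ltP (g x) (q k).
        left; split=> //=; have [_ _ _ + _] := FU (true, k); apply.
        by exists x.
      right; split=> //=; have [_ _ _ + _] := FU (false, k); apply.
      by exists x.
  apply: measure_bigcup_le => [k||k]; [exact: measurableU|exact: ltW|].
  rewrite (le_trans (measureU2 _ _ _))//.
  have -> : eps / (2 ^ k.+1)%:R =
      eps / 2 / (2 ^ k.+1)%:R + eps / 2 / (2 ^ k.+1)%:R by rewrite -mulrDl -splitr.
  by rewrite EFinD leeD//; [case: (FU (true, k))|case: (FU (false, k))].
(* [h] is [g] read in the coordinate [e]; the default 0 occurs only off the range of [e], hence off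
   [K']. *)
pose h (t : R) : R := xget 0 (g @` (e @^-1` [set t])).
have hE x : h (e x) = g x.
  rewrite /h; case: xgetP => [y _ [z /= /injective_e -> //]|/(_ (g x))].
  by case; exists x.
have rK' t : K' t -> exists x, e x = t.
  move=> /(_ 0%N I)[|] Ft.
    by have [_ _ /(_ _ Ft)[x _ <-] _ _] := FU (true, 0%N); exists x.
  by have [_ _ /(_ _ Ft)[x _ <-] _ _] := FU (false, 0%N); exists x.
have ch : {within K', continuous h}.
  apply/subspace_continuousP => t K't W /=.
  move: K't => /[dup] /rK' [x <-{t}] K'x; rewrite /from_subspace hE.
  move=> /nbhs_ballP[r /= r0 rW].
  have [k1 /andP[xk1 k1x]] : exists k, g x - r < q k < g x.
    by apply: rat_enum_dense; rewrite gtrBl.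
  have [k2 /andP[xk2 k2x]] : exists k, g x < q k < g x + r.
    by apply: rat_enum_dense; rewrite ltrDl.
  (* The closed sets for [g < q k1] and [q k2 <= g] miss [e x], hence a neighborhood of it; the
     points of [K'] there must come from [q k1 <= g < q k2]. *)
  have nx1 : ~ F (true, k1) (e x).
    move=> Fx; have [_ _ /(_ _ Fx)/= + _ _] := FU (true, k1).
    move=> [y /= gy /injective_e yx]; move: gy; rewrite yx.
    by rewrite ltNge (ltW k1x).
  have nx2 : ~ F (false, k2) (e x).
    move=> Fx; have [_ _ /(_ _ Fx)/= + _ _] := FU (false, k2).
    move=> [y /= gy /injective_e yx]; move: gy; rewrite yx.
    by rewrite leNgt xk2.
  suff : \forall s \near e x, K' s -> W (h s) by [].
  have : nbhs (e x) (~` F (true, k1) `&` ~` F (false, k2)).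
    apply: open_nbhs_nbhs; split=> //; apply: openI; apply: closed_openC.
      by case: (FU (true, k1)).
    by case: (FU (false, k2)).
  apply: filterS => s [n1 n2] K's; apply: rW.
  have [y ys] := rK' _ K's; rewrite -{s}ys hE in n1 n2 K's *.
  have [//|F1] := K's k1 I.
  have [F2|//] := K's k2 I.
  have {F1}gy1 : q k1 <= g y.
    have [_ _ /(_ _ F1)/= + _ _] := FU (false, k1).
    by move=> [z /= gz /injective_e <-].
  have {F2}gy2 : g y < q k2.
    have [_ _ /(_ _ F2)/= + _ _] := FU (true, k2).
    by move=> [z /= gz /injective_e <-].
  rewrite /ball/= ltr_distlC (lt_le_trans xk1 gy1)/=.
  exact: lt_trans k2x.
move=> a b.
suff -> : g @` (e @^-1` K' `&` e @^-1` `[a, b]%classic) =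
    h @` (`[a, b]%classic `&` K').
  apply: compact_measurable; apply: continuous_compact.
    by apply: continuous_subspaceW ch; exact: subIsetr.
  by apply: compact_closedI => //; exact: segment_compact.
apply/seteqP; split=> [_ [x [K'x abx] <-]|_ [t [abt K't] <-]].
  by exists (e x) => //; split.
have [x ext] := rK' _ K't.
by exists x; [split; rewrite /= ext|rewrite -hE ext].
Qed.
End borel_embedding.

(** * Splitting a finite-to-one map into injective pieces *)

Section injective_pieces.
Context (d : measure_display) (X : measurableType d) (R : realType).
Variables (mu : {finite_measure set X -> \bar R}) (e : X -> R).
Hypotheses (injective_e : injective e) (measurable_e : measurable_fun setT e)
  (measurable_image_e : forall A : set X, measurable A -> measurable (e @` A)).

Let measurable_preimage_e (B : set R) : measurable B -> measurable (e @^-1` B).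
Proof. by move=> mB; rewrite -[X in measurable X]setTI; exact: measurable_e. Qed.

Lemma seq_isolated (x : X) (s : seq X) : exists2 r : R, 0 < r &
  forall y, List.In y s -> y <> x -> r <= `|e y - e x|.
Proof.
elim: s => [|z s [r r0 IH]]; first by exists 1.
have [->|zx] := pselect (z = x).
  by exists r => // y [->//|]; exact: IH.
have zx0 : 0 < `|e z - e x|.
  by rewrite normr_gt0 subr_eq0; apply/eqP => /injective_e.
exists (Num.min r `|e z - e x|); first by rewrite lt_min r0.
by move=> y [<- _|ys yx]; rewrite ge_min ?lexx ?orbT// IH.
Qed.

(** Inside the Lusin set [K], take the points of a rational interval and remove the fibers of all
    values attained twice there. These sets cover [K] because fibers are finite, and injectivity
    carries measurability of images from intervals to all Borel subsets. Finitely many, made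
    disjoint, suffice up to [eps]. *)
Lemma injective_pieces (f : X -> X) (eps : R) : measurable_fun setT f ->
  (forall y, exists s : seq X, forall x, f x = y -> List.In x s) -> 0 < eps ->
  exists (N : nat) (P : nat -> set X),
  [/\ forall s C, measurable C -> C `<=` P s -> measurable (f @` C),
      forall s, measurable (P s),
      forall s, {in P s &, injective f},
      trivIset setT P &
      (mu (~` \bigcup_(s < N) P s) <= eps%:E)%E].
Proof.
move=> mf fin_f eps0.
have e2 : 0 < eps / 2 by rewrite divr_gt0.
have mpref (B : set X) : measurable B -> measurable (f @^-1` B).
  by move=> mB; rewrite -[X in measurable X]setTI; exact: mf.
have [K [mK muK mKf]] := lusin_interval_images mu
  injective_e measurable_e measurable_image_e
  (measurableT_comp measurable_e mf) e2.
pose V (a b : R) := K `&` e @^-1` `[a, b]%classic.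
have mV a b : measurable (V a b).
  by apply: measurableI => //; apply: measurable_preimage_e.
have {}mKf a b : measurable (f @` V a b).
  have -> : f @` V a b = e @^-1` ((e \o f) @` V a b).
    by apply/seteqP; split=> [_ [x Vx <-]|y /= [x Vx /injective_e <-]]; exists x.
  apply: measurable_preimage_e; exact: mKf.
pose q := rat_enum R.
pose lo k : R :=
  if (unpickle k : option (nat * nat)) is Some ab then q ab.1 else 0.
pose hi k : R :=
  if (unpickle k : option (nat * nat)) is Some ab then q ab.2 else 0.
have lohi i j : exists k, lo k = q i /\ hi k = q j.
  by exists (pickle (i, j)); rewrite /lo /hi pickleK.
(* [D k] is the set of points with two distinct preimages in the interval [k]
   of [K], separated by the interval [j]. *)
pose D k := \bigcup_(j in [set j | lo j < hi j])
  (f @` V (lo k) (Num.min (hi k) (lo j)) `&`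
   f @` V (Num.max (lo k) (hi j)) (hi k)).
have mD k : measurable (D k).
  by apply: bigcup_measurable => j _; exact: measurableI.
pose E k := V (lo k) (hi k) `\` f @^-1` D k.
have mE k : measurable (E k) by apply: measurableD => //; exact: mpref.
have injE k : {in E k &, injective f}.
  have nlt x y : E k x -> E k y -> f x = f y -> ~ e x < e y.
    move=> [[Kx /= xk] _] [[Ky /= yk] nD] fxy xy; apply: nD.
    move: xk yk; rewrite !in_itv/= => /andP[lx xh] /andP[ly yh].
    (* Two rationals between [e x] and [e y] bound an interval [l] separating them, which would put
       [f x] in [D k]. *)
    have [i /andP[xi iy]] := rat_enum_dense xy.
    have [j /andP[ij jy]] := rat_enum_dense iy.
    have [l [lol hil]] := lohi i j.
    exists l; first by rewrite /= lol hil.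
    split; [exists x => //|exists y => //]; split=> //=; rewrite in_itv/=.
      by rewrite lx le_min xh lol ltW.
    by rewrite yh ge_max ly hil ltW.
  move=> x y; rewrite !inE => Ex Ey fxy; apply: injective_e.
  apply/eqP; rewrite eq_le !leNgt; apply/andP; split; apply/negP; exact: nlt.
(* The removed set is a union of fibers, so taking images commutes with removing it. *)
have imE k (A : set X) : f @` (A `\` f @^-1` D k) = f @` A `\` D k.
  apply/seteqP; split=> [_ [x [Ax nD] <-]|_ [[x Ax <-] nD]]; last by exists x.
  by split=> //; exists x.
have mimE k C : measurable C -> C `<=` E k -> measurable (f @` C).
  move=> mC CE.
  have -> : C = E k `&` e @^-1` (e @` C).
    apply/seteqP; split=> [x Cx|x [_ [y Cy /injective_e <-]]//].
    by split; [exact: CE|exists x].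
  have : measurable (e @` C) by exact: measurable_image_e.
  (* The sets of reals whose trace on [E k] has measurable image form a sigma-algebra: complements
     use [injE], and a ray cuts [V] down to another closed interval. *)
  move: (e @` C); have -> : @measurable _ R = <<s @RGenCInfty.G R >>.
    exact: RGenCInfty.measurableE.
  apply: smallest_sub; last first.
    move=> _ [x ->].
    suff -> : E k `&` e @^-1` `[x, +oo[%classic =
        V (Num.max (lo k) x) (hi k) `\` f @^-1` D k.
      by rewrite /= imE; exact: measurableD.
    rewrite /E setDE setIAC -setDE; congr (_ `\` _).
    rewrite /V -setIA; congr (_ `&` _).
    apply/seteqP; split=> y; rewrite /= !in_itv/= ge_max andbT.
      by move=> [/andP[-> ->] ->].
    by move=> /andP[/andP[-> ->] ->].
  split.
  - by rewrite /= preimage_set0 setI0 image_set0.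
  - move=> B /= mB.
    have -> : E k `&` e @^-1` (setT `\` B) = E k `\` (E k `&` e @^-1` B).
      by rewrite setTD preimage_setC setDIr setDv set0U.
    have -> : f @` (E k `\` (E k `&` e @^-1` B)) =
        f @` E k `\` f @` (E k `&` e @^-1` B).
      apply/seteqP; split=> [_ [x [Ex nB] <-]|_ [[x Ex <-] nB]].
        split; first by exists x.
        move=> [y EBy fyx]; apply: nB; have <- // : y = x.
        by apply: (injE k) => //; rewrite inE//; case: EBy.
      by exists x => //; split => // EBx; apply: nB; exists x.
    by apply: measurableD => //; rewrite imE; exact: measurableD.
  - move=> F /= mF; rewrite preimage_bigcup setI_bigcupr image_bigcup.
    exact: bigcup_measurable.
have KE : K `<=` \bigcup_k E k.
  move=> x Kx; have [s hs] := fin_f (f x).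
  (* The rational interval around [x] is chosen so short that it contains no other point of the
     fiber. *)
  have [r r0 hr] := seq_isolated x s.
  have [i /andP[xi ix]] : exists k, e x - r < q k < e x.
    by apply: rat_enum_dense; rewrite gtrBl.
  have [j /andP[xj jx]] : exists k, e x < q k < e x + r.
    by apply: rat_enum_dense; rewrite ltrDl.
  have [k [lok hik]] := lohi i j.
  exists k => //; split.
    by split => //=; rewrite in_itv/= lok hik !ltW.
  have uniq y : f y = f x -> lo k <= e y <= hi k -> y = x.
    rewrite lok hik => fyx /andP[iy yj]; apply: contrapT => yx.
    have := hr _ (hs _ fyx) yx; rewrite leNgt ltr_distl.
    by rewrite (lt_le_trans xi iy) (le_lt_trans yj jx).
  move=> [l /= lhl [[y [_ /= hy] fy] [z [_ /= hz] fz]]].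
  move: hy hz; rewrite !in_itv/= le_min ge_max.
  move=> /and3P[y1 y2 y3] /andP[/andP[z1 z2] z3].
  have yx : y = x by apply: uniq; rewrite ?y1.
  have zx : z = x by apply: uniq; rewrite ?z1.
  by move: (lt_le_trans (le_lt_trans y3 lhl) z2); rewrite yx zx ltxx.
have mP s : measurable (seqDU E s) by exact: seqDU_measurable.
have [N hN] := measure_tail mu mP e2.
exists N, (seqDU E); split.
- move=> s C mC CP; apply: (mimE s) => // x Cx.
  exact: (@subset_seqDU _ E s x (CP x Cx)).
- by [].
- move=> s x y; rewrite !inE => Px Py.
  by apply: (injE s); rewrite inE; exact: (@subset_seqDU _ E s).
- exact: trivIset_seqDU.
rewrite [eps]splitr EFinD.
apply: le_trans (leeD muK (ltW hN)).
apply: le_trans (measureU2 _ _ _); [|exact: measurableC|].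
  apply: le_measure_sub.
  - by apply: measurableC; exact: bigcup_measurable.
  - by apply: measurableU; [exact: measurableC|
      apply: measurableD; exact: bigcup_measurable].
  move=> x nx; have [Kx|] := pselect (K x); last by left.
  by right; split => //; rewrite -seqDU_bigcup_eq; exact: KE.
by apply: measurableD; exact: bigcup_measurable.
Qed.
End injective_pieces.

(** * Countably many independent Borel sets *)

(** Points are grouped by labels: for each [i], either [f i x = x], or a rational strictly between
    [e x] and [e (f i x)] with the direction. If [x] and [y = f i x] shared a label, then [x = y] or
    [e y] would lie on both sides of one rational. *)
Lemma countable_independent_cover (d : measure_display) (X : measurableType d)
    (R : realType) (e : X -> R) (n : nat) (f : 'I_n -> X -> X) :
  injective e -> measurable_fun setT e -> (forall i, measurable_fun setT (f i)) ->
  exists C : nat -> set X, [/\ forall m, measurable (C m),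
    forall m x y, C m x -> C m y -> ~ gen_graph f x y & \bigcup_m C m = setT].
Proof.
move=> inje me mf.
pose Q i (o : option (bool * nat)) : set X :=
  match o with
  | None => [set x | e (f i x) == e x]
  | Some (true, k) => [set x | e x < rat_enum R k < e (f i x)]
  | Some (false, k) => [set x | e (f i x) < rat_enum R k < e x]
  end.
have mQ i o : measurable (Q i o).
  have mef : measurable_fun setT (e \o f i) by exact: measurableT_comp.
  have mpre (b : X -> bool) : measurable_fun setT b -> measurable [set x | b x].
    move=> /(_ measurableT [set true] I); rewrite setTI.
    by congr (measurable _); apply/seteqP; split=> x /=.
  case: o => [[[] k]|] /=; apply: mpre.
  - by apply: measurable_and; exact: measurable_fun_ltr.
  - by apply: measurable_and; exact: measurable_fun_ltr.
  - exact: measurable_fun_eqr.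
pose C m := if (unpickle m : option {ffun 'I_n -> option (bool * nat)}) is Some t
  then \bigcap_i Q i (t i) else set0.
exists C; split.
- move=> m; rewrite /C; case: unpickle => // t; exact: fin_bigcap_measurable.
- suff h m x y : C m x -> C m y -> forall i, f i x = y -> x = y.
    move=> m x y Cx Cy [xy [i [fxy|fyx]]]; apply: xy.
      exact: (h m x y Cx Cy i).
    by apply/esym; apply: (h m y x Cy Cx i).
  rewrite /C; case: unpickle => // t Cx Cy i fxy.
  move: (Cx i I) (Cy i I); rewrite /Q; case: (t i) => [[[] k]|] /=; rewrite fxy.
  + by move=> /andP[_ ky] /andP[yk _]; move: (lt_trans ky yk); rewrite ltxx.
  + by move=> /andP[yk _] /andP[_ ky]; move: (lt_trans ky yk); rewrite ltxx.
  + by move=> /eqP /inje.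
- apply/seteqP; split=> // x _.
  have /choice[t ht] : forall i, exists o, Q i o x.
    move=> i; have [xf|fx|xf] := ltgtP (e x) (e (f i x)).
    + by have [k hk] := rat_enum_dense xf; exists (Some (true, k)).
    + by have [k hk] := rat_enum_dense fx; exists (Some (false, k)).
    + by exists None; rewrite /= xf.
  exists (pickle [ffun i => t i]) => //.
  by rewrite /C pickleK => i _; rewrite ffunE.
Qed.

(** * Counting memberships in finitely many sets *)

Lemma count_ge_measurable (d : measure_display) (X : measurableType d)
    (I : finType) (E : I -> set X) (m : nat) :
  (forall i, measurable (E i)) ->
  measurable [set x | (m <= \sum_i (`[< E i x >] : nat))%N].
Proof.
move=> mE.
have -> : [set x | (m <= \sum_i (`[< E i x >] : nat))%N] =
    \bigcup_(J in [set J : {set I} | (m <= #|J|)%N]) \bigcap_(i in [set` J]) E i.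
  have cardE x : #|finset (fun i => `[< E i x >])| = (\sum_i `[< E i x >])%N.
    rewrite -sum1_card big_mkcond /=; apply: eq_bigr => i _.
    by rewrite inE; case: asbool.
  apply/seteqP; split=> x /=.
    rewrite -cardE => mx; exists (finset (fun i => `[< E i x >])) => // i /=.
    by rewrite inE => /asboolP.
  move=> [J /= mJ xJ]; apply: leq_trans mJ _; rewrite -cardE.
  apply: subset_leq_card; apply/fintype.subsetP => i iJ.
  by rewrite inE; apply/asboolP/xJ.
apply: fin_bigcup_measurable => [|J _]; first exact: finite_finset.
apply: fin_bigcap_measurable => //; exact: finite_finset.
Qed.

(** Markov's inequality for the sum of the indicators of the [E i], whose integral is the right-hand
    side. *)
Lemma count_markov (d : measure_display) (X : measurableType d) (R : realType)
    (mu : {measure set X -> \bar R}) (I : finType) (E : I -> set X) (m : nat) :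
  (forall i, measurable (E i)) ->
  (m%:R%:E * mu [set x | (m <= \sum_i (`[< E i x >] : nat))%N] <= \sum_i mu (E i))%E.
Proof.
move=> mE; set B := [set x | _].
have mB : measurable B by exact: count_ge_measurable.
have -> : (\sum_i mu (E i) = \int[mu]_x \sum_i (\1_(E i) x)%:E)%E.
  rewrite ge0_integral_sum//.
    by apply: eq_bigr => i _; rewrite integral_indic// setIT.
  by move=> i; apply/measurable_EFinP.
rewrite -integral_cst//.
have mS : measurable_fun setT (fun x => \sum_i (\1_(E i) x)%:E : \bar R)%E.
  by apply: emeasurable_sum => i; apply/measurable_EFinP.
apply: (@le_trans _ _ (\int[mu]_(x in B) \sum_i (\1_(E i) x)%:E)%E); last first.
  apply: ge0_subset_integral => //.
  by move=> x _; apply: sume_ge0 => i _; rewrite lee_fin.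
apply: ge0_le_integral => //.
- by move=> x _; rewrite lee_fin.
- exact: measurable_funS mS.
move=> x; rewrite /B /= => mx.
rewrite sumEFin lee_fin.
have -> : \sum_i \1_(E i) x = (\sum_i (`[< E i x >] : nat))%N%:R :> R.
  by rewrite natr_sum; apply: eq_bigr => i _; rewrite indicE.
by rewrite ler_nat.
Qed.

(** * Greedy coloring of the peeled layers *)

Section greedy_coloring.
Context (d : measure_display) (X : measurableType d) (n N : nat).
Variables (f : 'I_n -> X -> X) (P : 'I_n * 'I_N -> set X) (K : set X).
Hypotheses (measurable_f : forall i, measurable_fun setT (f i))
  (measurable_P : forall s, measurable (P s))
  (measurable_image_f : forall s (C : set X),
    measurable C -> C `<=` P s -> measurable (f s.1 @` C))
  (injective_f : forall s, {in P s &, injective (f s.1)})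
  (K_cover : forall i x, K x -> exists r, P (i, r) x).

Definition in_image (A : set X) (s : 'I_n * 'I_N) : set X :=
  f s.1 @` (A `&` P s).

(** Incoming edges are counted by function and piece: by injectivity on pieces, each pair stands for
    at most one preimage of [x] in [A]. *)
Definition indegree (A : set X) (x : X) : nat :=
  (\sum_s (`[< in_image A s x >] : nat))%N.

(** This is the part that remains; the layer taken off is its complement in [A]. *)
Definition peel (A : set X) : set X := A `&` [set x | n < indegree A x]%N.

Definition borel_colorable (k : nat) (U : set X) := exists c : X -> nat,
  [/\ forall x, U x -> (c x < k)%N,
      forall j, measurable (U `&` c @^-1` [set j]) &
      forall x y, U x -> U y -> gen_graph f x y -> c x <> c y].

Lemma measurable_in_image A s : measurable A -> measurable (in_image A s).
Proof.
by move=> mA; apply: measurable_image_f; [exact: measurableI|exact: subIsetr].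
Qed.

Lemma measurable_peel A : measurable A -> measurable (peel A).
Proof.
move=> mA; apply: measurableI => //; apply: count_ge_measurable => s.
exact: measurable_in_image.
Qed.

Lemma peel_sub A : peel A `<=` A. Proof. exact: subIsetl. Qed.

Lemma iter_peel_sub q A : iter q peel A `<=` A.
Proof.
elim: q => [//|q IH]; rewrite iterS; apply: subset_trans IH; exact: peel_sub.
Qed.

Lemma measurable_iter_peel q A : measurable A -> measurable (iter q peel A).
Proof.
by move=> mA; elim: q => [//|q IH]; rewrite iterS; exact: measurable_peel.
Qed.

Lemma measurable_neighborhood U : measurable U -> U `<=` K ->
  measurable (\bigcup_i (f i @^-1` U) `|` \bigcup_s in_image U s).
Proof.
move=> mU UK; apply: measurableU.
  apply: fin_bigcup_measurable => // i _.
  by rewrite -[X in measurable X]setTI; exact: measurable_f.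
by apply: fin_bigcup_measurable => // s _; exact: measurable_in_image.
Qed.

(** An edge between [x] and [U] leaves [x] along some [f i] or comes from a point of [U], which lies
    in a piece since [U] is inside [K]. Sets of points with a forbidden color thereby become
    measurable. *)
Lemma gen_graph_neighborhood U x : U `<=` K -> ~ U x ->
  (exists2 y, U y & gen_graph f x y) <->
  (\bigcup_i (f i @^-1` U) `|` \bigcup_s in_image U s) x.
Proof.
move=> UK nUx; split=> [[y Uy [xy [i [fxy|fyx]]]]|].
- by left; exists i => //; rewrite /preimage/= fxy.
- right; have [r Pr] := K_cover i (UK _ Uy).
  by exists (i, r) => //; exists y.
- have ne y : U y -> x <> y by move=> Uy xy; apply: nUx; rewrite xy.
  move=> [[i _ /= Uf]|[s _ [y [Uy _] fyx]]].
    by exists (f i x) => //; split; [exact: ne|exists i; left].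
  by exists y => //; split; [exact: ne|exists s.1; right].
Qed.

(** Pigeonhole: [x] has at most [n] neighbors by outgoing edges and at most [indegree A x] in [A] by
    incoming ones, together fewer than the [2 * n + 1] colors. *)
Lemma free_color A x (c : X -> nat) (U : set X) : A `<=` K -> U `<=` A ->
  (indegree A x <= n)%N ->
  exists2 j, (j < 2 * n + 1)%N & ~ exists2 y, U y & c y = j /\ gen_graph f x y.
Proof.
move=> AK UA degx; apply: contrapT => nfree.
have /choice[y hy] : forall j : 'I_(2 * n + 1),
    exists y, U y /\ c y = j /\ gen_graph f x y.
  move=> j; apply: contrapT => nj; apply: nfree; exists j => //.
  by move=> [y Uy h]; apply: nj; exists y.
(* A neighbor of [x] in [A] is determined by its label: the function sending [x]
   to it, or the function and the piece by which it is sent to [x]. *)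
pose ok (l : 'I_n + 'I_n * 'I_N) (z : X) := match l with
  | inl i => f i x = z
  | inr s => [/\ A z, P s z & f s.1 z = x]
  end.
have /choice[lab hlab] : forall j, exists l, ok l (y j).
  move=> j; have [Uy [_ [_ [i [fxy|fyx]]]]] := hy j; first by exists (inl i).
  have Ay := UA _ Uy; have [r Pr] := K_cover i (AK _ Ay).
  by exists (inr (i, r)).
have inj_lab : injective lab.
  move=> j1 j2 l12; apply/val_inj => /=.
  have [_ [<- _]] := hy j1; have [_ [<- _]] := hy j2; congr c.
  have := hlab j1; have := hlab j2; rewrite l12; case: (lab j2) => [i|s] /=.
    by move=> <- <-.
  move=> [_ P2 f2] [_ P1 f1]; apply: (@injective_f s); rewrite ?inE//.
  by rewrite f1 f2.
pose L := finset (fun l : 'I_n + 'I_n * 'I_N =>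
  if l is inr s then `[< in_image A s x >] else true).
have : (#|codom lab| <= #|L|)%N.
  apply: subset_leq_card; apply/fintype.subsetP => _ /codomP[j ->].
  rewrite inE; have := hlab j; case: (lab j) => [//|s] /= [Ay Py fy].
  by apply/asboolP; exists (y j).
rewrite card_codom// card_ord.
have -> : (#|L| = n + indegree A x)%N.
  rewrite -sum1_card big_mkcond big_sumType/=; congr (_ + _)%N.
    under eq_bigr do rewrite inE.
    by rewrite sum1_card card_ord.
  by apply: eq_bigr => s _; rewrite inE; case: asbool.
lia.
Qed.

(** As [Z] is independent, all its points can take their least free color at once without
    conflict. *)
Lemma greedy_step A U Z : A `<=` K -> U `<=` A ->
  measurable U -> measurable Z -> (forall x, Z x -> ~ U x) ->
  (forall x y, Z x -> Z y -> ~ gen_graph f x y) ->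
  (forall x, Z x -> (indegree A x <= n)%N) ->
  borel_colorable (2 * n + 1) U -> borel_colorable (2 * n + 1) (U `|` Z).
Proof.
move=> AK UA mU mZ ZU indZ degZ [c [ck mc properc]].
pose forb x j := `[< exists2 y, U y & c y = j /\ gen_graph f x y >].
(* [find] would return [2 * n + 1] if every color were forbidden; [hasZ] excludes this on [Z]. *)
pose c' x := if `[< U x >] then c x
  else find (fun j => ~~ forb x j) (iota 0 (2 * n + 1)).
have cU x : U x -> c' x = c x by move=> Ux; rewrite /c'; case: asboolP.
have cZ x : Z x -> c' x = find (fun j => ~~ forb x j) (iota 0 (2 * n + 1)).
  by move=> /ZU nUx; rewrite /c'; case: asboolP.
have hasZ x : Z x -> has (fun j => ~~ forb x j) (iota 0 (2 * n + 1)).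
  move=> Zx; have [j jn nj] := free_color c AK UA (degZ _ Zx).
  apply/hasP; exists j; first by rewrite mem_iota.
  by apply/asboolPn.
have ltZ x : Z x -> (c' x < 2 * n + 1)%N.
  by move=> Zx; rewrite cZ//; move: (hasZ _ Zx); rewrite has_find size_iota.
have freeZ x : Z x -> ~~ forb x (c' x).
  move=> Zx; have := nth_find 0%N (hasZ _ Zx); rewrite -cZ// nth_iota//.
  exact: ltZ.
have forbZ x j : Z x -> (j < c' x)%N -> forb x j.
  move=> Zx jc; have jn := ltn_trans jc (ltZ _ Zx).
  move: jc; rewrite cZ// => /(before_find 0%N); rewrite nth_iota//.
  by move/negbFE.
have mforb j : measurable (Z `&` [set x | forb x j]).
  pose V := U `&` c @^-1` [set j].
  have VK : V `<=` K by move=> x [/UA /AK].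
  have -> : Z `&` [set x | forb x j] =
      Z `&` (\bigcup_i (f i @^-1` V) `|` \bigcup_s in_image V s).
    have nV x : Z x -> ~ V x by move=> Zx [Ux _]; exact: (ZU x).
    apply/seteqP; split=> x [Zx] h; split=> //.
      apply: (gen_graph_neighborhood VK (nV _ Zx)).1.
      by move: h => /asboolP[y Uy [cy G]]; exists y.
    have [y [Uy cy] G] := (gen_graph_neighborhood VK (nV _ Zx)).2 h.
    by apply/asboolP; exists y.
  by apply: measurableI => //; apply: measurable_neighborhood => //; exact: mc.
exists c'; split.
- by move=> x [Ux|/ltZ//]; rewrite cU//; exact: ck.
- move=> j.
  have -> : (U `|` Z) `&` c' @^-1` [set j] =
      (U `&` c @^-1` [set j]) `|` (Z `&` c' @^-1` [set j]).
    apply/seteqP; split=> x.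
      by move=> [[Ux|Zx] /= cj]; [left; rewrite -cj cU|right].
    by move=> [[Ux /= cj]|[Zx cj]]; split => //; [left|rewrite /= cU|right].
  apply: measurableU => //.
  have [jn|nj] := ltnP j (2 * n + 1); last first.
    rewrite (_ : _ `&` _ = set0)//; apply/seteqP; split=> // x [/ltZ + /= cj].
    by rewrite cj ltnNge nj.
  (* The least free color is [j] when [j] is not forbidden and every smaller color is. *)
  have -> : Z `&` c' @^-1` [set j] =
      (Z `\` (Z `&` [set x | forb x j])) `&`
      \bigcap_(i in `I_j) (Z `&` [set x | forb x i]
         `|` ~` Z).
    apply/seteqP; split=> x.
      move=> [Zx /= cj]; split.
        by split=> // -[_]; apply/negP; rewrite -cj; exact: freeZ.
      by move=> i /= ij; left; split => //; apply: forbZ; rewrite // cj.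
    move=> [[Zx nf] lf]; split=> //=.
    have [cj|jc|//] := ltngtP (c' x) j.
      have [[_ /= h]|//] := lf _ cj.
      by move: (freeZ _ Zx); rewrite h.
    by exfalso; apply: nf; split=> //; exact: forbZ.
  apply: measurableI; first exact: measurableD.
  apply: fin_bigcap_measurable => [|i _]; first exact: finite_II.
  by apply: measurableU => //; exact: measurableC.
- move=> x y [Ux|Zx] [Uy|Zy] G.
  + by rewrite !cU//; exact: properc.
  + rewrite (cU _ Ux) => cxy; move: (freeZ _ Zy); rewrite -cxy => /asboolPn; apply.
    exists x => //; split => //.
    by case: G => xy [i h]; split; [exact: nesym|exists i; case: h; [right|left]].
  + rewrite (cU _ Uy) => cxy; move: (freeZ _ Zx); rewrite cxy => /asboolPn; apply.
    by exists y.
  + by have := indZ _ _ Zx Zy.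
Qed.

(** Induction on the number of layers: those inside [peel A] come first, then the outermost one in
    [T] rounds. All points colored so far lie in [A], where a point of the outermost layer has
    indegree at most [n]. *)
Lemma peel_colorable (C : nat -> set X) (T q : nat) A :
  (forall m, measurable (C m)) ->
  (forall m x y, C m x -> C m y -> ~ gen_graph f x y) ->
  measurable A -> A `<=` K ->
  borel_colorable (2 * n + 1) ((A `\` iter q peel A) `&` \bigcup_(m < T) C m).
Proof.
move=> mC indC; elim: q A => [|q IH] A mA AK.
  by rewrite /= setDv set0I; exists (fun=> 0%N); split=> // j; rewrite set0I.
pose D t := \bigcup_(m < t) C m.
have mD t : measurable (D t) by exact: bigcup_measurable.
(* [U0] is the set that the induction hypothesis colors, applied to [peel A]. *)
pose U0 := (peel A `\` iter q.+1 peel A) `&` D T.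
have mU0 : measurable U0.
  apply: measurableI => //; apply: measurableD; first exact: measurable_peel.
  exact: measurable_iter_peel.
have U0A : U0 `<=` A by move=> x [[/peel_sub]].
suff h t : borel_colorable (2 * n + 1) (U0 `|` ((A `\` peel A) `&` D t)).
  have -> // : (A `\` iter q.+1 peel A) `&` D T =
      U0 `|` ((A `\` peel A) `&` D T).
  apply/seteqP; split=> x.
    move=> [[Ax nx] DT]; have [px|npx] := pselect (peel A x); last by right.
    by left.
  move=> [[[px nx] DT]|[[Ax nx] DT]]; split=> //; split=> //.
    exact: peel_sub px.
  by move=> /= ix; apply: nx; move: ix; rewrite -iterS iterSr; exact: iter_peel_sub.
elim: t => [|t IHt].
  rewrite /D bigcup_mkord big_ord0 setI0 setU0 /U0 iterSr.
  by apply: IH; [exact: measurable_peel|move=> x [/AK]].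
have -> : U0 `|` ((A `\` peel A) `&` D t.+1) =
    (U0 `|` ((A `\` peel A) `&` D t)) `|`
    (((A `\` peel A) `&` C t) `\` D t).
  have DS x : D t.+1 x <-> D t x \/ C t x.
    by rewrite /D !bigcup_mkord big_ord_recr.
  apply/seteqP; split=> x.
    move=> [U0x|[Ax /DS Dx]]; first by left; left.
    have [Dtx|nDx] := pselect (D t x); first by left; right.
    by right; split => //; split => //; case: Dx.
  move=> [[U0x|[Ax Dx]]|[[Ax Cx] _]]; first by left.
    by right; split=> //; apply/DS; left.
  by right; split=> //; apply/DS; right.
have mB : measurable (A `\` peel A).
  by apply: measurableD => //; exact: measurable_peel.
apply: (greedy_step AK) => //.
- by move=> x [/U0A//|[[]]].
- by apply: measurableU => //; apply: measurableI.
- by apply: measurableD => //; apply: measurableI.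
- by move=> x [[[Ax npx] Cx] nD] [[[px _] _]|[_ Dx]].
- by move=> x y [[_ Cx] _] [[_ Cy] _]; exact: indC Cx Cy.
- move=> x [[[Ax npx] _] _]; rewrite leqNgt; apply/negP => h; exact: npx.
Qed.
End greedy_coloring.

(** * Geometric decay of the remaining measure *)

Section peel_measure.
Context (d : measure_display) (X : measurableType d) (R : realType) (n N : nat).
Variables (mu : {finite_measure set X -> \bar R}) (f : 'I_n -> X -> X)
  (P : 'I_n * 'I_N -> set X).
Hypotheses (measurable_f : forall i, measurable_fun setT (f i))
  (measurable_P : forall s, measurable (P s))
  (measurable_image_f : forall s (C : set X),
    measurable C -> C `<=` P s -> measurable (f s.1 @` C))
  (injective_f : forall s, {in P s &, injective (f s.1)})
  (disjoint_P : forall i r r' x, P (i, r) x -> P (i, r') x -> r = r')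
  (pmp_f : pmp_graph mu (gen_graph f)).

(** On [P s] the map [f s.1] is a partial Borel bijection that fixes points or moves them along
    edges, so it preserves [mu]. *)
Lemma pmp_in_image A s : measurable A -> mu (in_image f P A s) = mu (A `&` P s).
Proof.
move=> mA; apply: (pmp_f (measurable_P s) (measurable_image_f (measurable_P s)
  (@subset_refl _ _)) _ (@injective_f s)) => //.
- exact: measurable_funS (measurable_f s.1).
- by move=> C mC CP; exact: measurable_image_f CP.
- move=> x _; have [fx|xf] := pselect (x = f s.1 x).
    by rewrite -fx; exact: rt_refl.
  by apply: rt_step; split => //; exists s.1; left.
- exact: measurableI.
Qed.

(** By invariance the images have the total mass of the sets they come from, at most [n * mu A]
    since the pieces of each [f i] are disjoint; Markov's inequality at [n + 1] concludes. *)
Lemma peel_measure A : measurable A ->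
  (mu (peel f P A) <= (n%:R / n.+1%:R)%:E * mu A)%E.
Proof.
move=> mA.
have fA : mu A \is a fin_num by exact: fin_num_measure.
have mI s : measurable (in_image f P A s) by exact: measurable_in_image.
have sumE : (\sum_s mu (in_image f P A s) <= n%:R%:E * mu A)%E.
  under eq_bigr do rewrite pmp_in_image//.
  have -> : (\sum_s mu (A `&` P s) = \sum_i \sum_r mu (A `&` P (i, r)))%E.
    by rewrite pair_bigA; apply: eq_bigr => -[].
  apply: (@le_trans _ _ (\sum_(i < n) mu A)%E).
    apply: lee_sum => i _.
    rewrite -measure_bigsetU_ord//.
    - apply: le_measure_sub => //.
        by apply: bigsetU_measurable => r _; exact: measurableI.
      by elim/big_ind : _ => [//|B C BA CA x [/BA|/CA]//|r _ x []].
    - by move=> r; exact: measurableI.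
    - by move=> r r' _ _ [x [[_ Px] [_ Px']]]; exact: disjoint_P Px Px'.
  by rewrite -(fineK fA) sumEFin sumr_const card_ord -EFinM mulr_natl.
have : (n.+1%:R%:E * mu (peel f P A) <= n%:R%:E * mu A)%E.
  apply: le_trans sumE; apply: le_trans (count_markov mu n.+1 mI).
  apply: lee_wpmul2l; first by rewrite lee_fin.
  apply: le_measure_sub; [exact: measurable_peel| |exact: subIsetr].
  exact: count_ge_measurable.
have fP : mu (peel f P A) \is a fin_num.
  by apply: fin_num_measure; exact: measurable_peel.
rewrite -(fineK fA) -(fineK fP) -!EFinM !lee_fin => h.
by rewrite mulrAC ler_pdivlMr// mulrC.
Qed.

Lemma iter_peel_measure q A : measurable A ->
  (mu (iter q (peel f P) A) <= ((n%:R / n.+1%:R) ^+ q)%:E * mu A)%E.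
Proof.
move=> mA; elim: q => [|q IH]; first by rewrite expr0 mul1e.
rewrite iterS exprS EFinM -muleA.
apply: le_trans (peel_measure _) _; first exact: measurable_iter_peel.
by apply: lee_wpmul2l => //; rewrite lee_fin divr_ge0.
Qed.

End peel_measure.

(** * Choice of parameters and the final estimate *)

Theorem theorem5p6 (d : measure_display) (X : measurableType d) (R : realType)
  (mu : probability X R) (n : nat) (f : 'I_n -> X -> X) :
  standard_borel X R ->
  (forall i, measurable_fun setT (f i)) ->
  (forall i, bounded_to_one (f i)) ->
  pmp_graph mu (gen_graph f) ->
  chi_ap_le mu (gen_graph f) (2 * n + 1).
Proof.
move=> [e [inje [me [_ ime]]]] mf bf pmp.
exists (2 * n + 1)%N; split=> // eps eps0.
(* Three losses of at most [eta] each will occur, and [3 * eta < eps]. *)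
pose eta := eps / 4; have eta0 : 0 < eta by rewrite divr_gt0.
have /choice[N0 /choice[P0 hP0]] : forall i : 'I_n, exists M (P : nat -> set X),
  [/\ forall s C, measurable C -> C `<=` P s -> measurable (f i @` C),
      forall s, measurable (P s),
      forall s, {in P s &, injective (f i)},
      trivIset setT P &
      (mu (~` \bigcup_(s < M) P s) <= (eta / (2 ^ i.+1)%:R)%:E)%E].
  move=> i; apply: (injective_pieces mu inje me ime) => //; last by rewrite divr_gt0.
  by move=> y; have [M /(_ y)[s [_ hs]]] := bf i; exists s.
(* One number of pieces serves all functions; taking more pieces only enlarges what they cover. *)
pose N := \max_(i < n) N0 i.
pose P (s : 'I_n * 'I_N) := P0 s.1 s.2.
have mP s : measurable (P s) by have [_ + _ _ _] := hP0 s.1; apply.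
have imP s (C : set X) : measurable C -> C `<=` P s -> measurable (f s.1 @` C).
  by have [+ _ _ _ _] := hP0 s.1; apply.
have injP s : {in P s &, injective (f s.1)} by have [_ _ + _ _] := hP0 s.1; apply.
have disjP i r r' x : P (i, r) x -> P (i, r') x -> r = r'.
  move=> Px Px'; apply/val_inj => /=.
  case: (hP0 i) => _ _ _ + _; apply => //.
  by exists x.
(* The exceptional sets are indexed by all naturals, empty from [n] on, to match the geometric
   bounds. *)
pose F k := if (insub k : option 'I_n) is Some i
  then ~` \bigcup_(s < N0 i) P0 i s else set0.
have mF k : measurable (F k).
  rewrite /F; case: insub => // i; apply: measurableC.
  apply: bigcup_measurable => s _.
  by have [_ + _ _ _] := hP0 i; apply.
pose K := ~` \bigcup_k F k.
have mK : measurable K by apply: measurableC; exact: bigcup_measurable.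
have muK : (mu (~` K) <= eta%:E)%E.
  rewrite setCK; apply: measure_bigcup_le => // [|k]; first exact: ltW.
  rewrite /F; case: insubP => [i _ <-|_]; first by case: (hP0 i).
  by rewrite measure0 lee_fin divr_ge0// ltW.
have KP i x : K x -> exists r, P (i, r) x.
  move=> Kx; have : ~ F i x by move=> Fx; apply: Kx; exists (val i).
  rewrite /F valK => /contrapT[s /= si Px].
  have sN : (s < N)%N by apply: leq_trans si _; exact: (leq_bigmax i).
  by exists (Ordinal sN).
have [C [mC indC covC]] := countable_independent_cover inje me mf.
have [T hT] := measure_tail mu mC eta0.
have [q hq] : exists q, (n%:R / n.+1%:R) ^+ q < eta.
  have : (fun q => (n%:R / n.+1%:R : R) ^+ q) @ \oo --> 0.
    apply: cvg_expr; rewrite ger0_norm ?divr_ge0//.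
    by rewrite ltr_pdivrMr// mul1r ltr_nat.
  move=> /cvgrPdist_lt/(_ _ eta0)[q _ /(_ q (leqnn q))].
  by rewrite sub0r normrN ger0_norm ?exprn_ge0 ?divr_ge0//; exists q.
pose L := iter q (peel f P) K.
have mL : measurable L by exact: measurable_iter_peel.
have muL : (mu L < eta%:E)%E.
  apply: le_lt_trans (iter_peel_measure mf mP imP injP disjP pmp q mK) _.
  apply: (@le_lt_trans _ _ ((n%:R / n.+1%:R) ^+ q)%:E); last by rewrite lte_fin.
  rewrite -[leRHS]mule1; apply: lee_wpmul2l; last exact: probability_le1.
  by rewrite lee_fin exprn_ge0// divr_ge0.
pose D := \bigcup_(m < T) C m.
have mD : measurable D by exact: bigcup_measurable.
have [c [ck mc properc]] :=
  peel_colorable mf mP imP injP KP T q mC indC mK (@subset_refl _ K).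
rewrite -/L -/D in ck mc properc.
have mA : measurable ((K `\` L) `&` D).
  by apply: measurableI => //; exact: measurableD.
exists ((K `\` L) `&` D); split=> //; split.
  rewrite -[X in mu X]setCK probability_setC; last exact: measurableC.
  set A := (K `\` L) `&` D in mA *.
  have mT : measurable (\bigcup_i C i `\` D).
    by apply: measurableD => //; exact: bigcup_measurable.
  have mKL : measurable (~` K `|` L) by apply: measurableU => //; exact: measurableC.
  (* A point outside [A] is outside [K], or in the unpeeled rest [L], or in no [C m] with
     [m < T]. *)
  have : (mu (~` A) < eps%:E)%E.
    apply: (@le_lt_trans _ _ (mu ((~` K `|` L) `|` (\bigcup_i C i `\` D)))).
      apply: le_measure_sub; [exact: measurableC|exact: measurableU|].
      move=> x nA; have [Dx|nD] := pselect (D x); last by right; rewrite covC.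
      left; have [Kx|] := pselect (K x); last by left.
      by right; apply: contrapT => nL; apply: nA.
    apply: (@lt_trans _ _ (eta + eta + eta)%:E); last first.
      by rewrite lte_fin /eta; lra.
    rewrite !EFinD; apply: le_lt_trans (measureU2 _ _ _) _ => //.
    apply: lteD => //; apply: le_lt_trans (measureU2 _ _ _) _ => //.
      exact: measurableC.
    by apply: lee_ltD => //; apply: fin_num_measure; exact: measurableC.
  have fA : mu (~` A) \is a fin_num by apply: fin_num_measure; exact: measurableC.
  by rewrite -(fineK fA) -EFinB !lte_fin => h; rewrite ltrD2l ltrN2.
exists c; split=> //; split=> // j.
(* The color classes are themselves measurable, so the null set is empty. *)
exists (((K `\` L) `&` D) `&` c @^-1` [set j]), set0; split; first exact: mc.
by split=> //; split; [exact: measure0|rewrite setDv setU0].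
Qed.
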